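(* Let $\lambda_g,\lambda_s,b,c\in\mathbb{C}$ and $\varepsilon\ge 0$. The eigenvalues of the matrix $$M_r(\varepsilon)=\begin{bmatrix}\lambda_g & b\\ \varepsilon c&\lambda_s\end{bmatrix}$$ are $$\lambda_{\pm}=\frac{\lambda_g+\lambda_s}{2}\pm\sqrt{\left(\frac{\lambda_g-\lambda_s}{2}\right)^2+\varepsilon bc}.$$
   Context: The matrix $M_r(\varepsilon)$ is a reduced two-mode model of a source--grid interconnection: $\lambda_g$ is a retained grid eigenvalue, $\lambda_s$ a retained source eigenvalue, $b$ and $c$ are the modal source-to-grid and grid-to-source coupling coefficients, and $\varepsilon\ge 0$ is a scalar feedback-strength parameter. The square root denotes either complex square root of its argument; the other choice interchanges $\lambda_+$ and $\lambda_-$. *)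

(* Defs.v *)
From mathcomp Require Import all_boot all_order all_algebra.
From mathcomp Require Import reals complex.

Set Implicit Arguments.
Unset Strict Implicit.
Unset Printing Implicit Defensive.

Import GRing.Theory Num.Theory.
Local Open Scope ring_scope.
Local Open Scope complex_scope.

Definition Mr (R : realType) (lg ls b c : R[i]) (eps : R) : 'M[R[i]]_2 :=
  \matrix_(i < 2, j < 2)
    if i == 0 then (if j == 0 then lg else b)
    else (if j == 0 then eps%:C * c else ls).

(* [s] stands for a chosen value of the complex square root in the formula;
   [lambda_minus] is [lambda_plus] for the other choice [- s]. *)
Definition lambda_plus (R : realType) (lg ls s : R[i]) : R[i] :=
  (lg + ls) / 2 + s.

Definition lambda_minus (R : realType) (lg ls s : R[i]) : R[i] :=
  (lg + ls) / 2 - s.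

(* Main.v *)
Require Import Defs.
From mathcomp Require Import all_boot all_order all_algebra.
From mathcomp Require Import reals complex.
From mathcomp Require Import ring.

Import GRing.Theory Num.Theory.
Local Open Scope ring_scope.
Local Open Scope complex_scope.

(** A monic quadratic is determined by the sum and product of its roots. By [char_poly22] the
    coefficients here are the trace [lg + ls] and the determinant [lg * ls - b * (eps%:C * c)]; the
    two candidates have exactly this sum and product, so the characteristic polynomial splits as
    claimed, which also accounts for multiplicity when [s = 0]. *)

Lemma char_poly22 (A : comNzRingType) (M : 'M[A]_2) :
  char_poly M = 'X^2 - (M 0 0 + M 1 1)%:P * 'X
                + (M 0 0 * M 1 1 - M 0 1 * M 1 0)%:P.
Proof.
(* These two identities name the single index left in a 1x1 minor once index 0 or 1 is deleted. *)
have lift00 : lift ord0 ord0 = 1 :> 'I_2 by apply: val_inj.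
have lift10 : lift 1 ord0 = 0 :> 'I_2 by apply: val_inj.
rewrite /char_poly (expand_det_row _ ord0) !big_ord_recl big_ord0 /cofactor.
rewrite !det_mx11 !mxE /= !lift00 !lift10 /bump /=.
rewrite !(mulr1n, mulr0n, polyCD, polyCN, polyCM).
by ring.
Qed.

Theorem theorem2 (R : realType) (lg ls b c : R[i]) (eps : R)
    (heps : 0 <= eps) (s : R[i])
    (hs : s ^+ 2 = ((lg - ls) / 2) ^+ 2 + eps%:C * b * c) :
  (forall x : R[i], eigenvalue (Mr lg ls b c eps) x <->
     x = lambda_plus lg ls s \/ x = lambda_minus lg ls s) /\
  char_poly (Mr lg ls b c eps) =
    ('X - (lambda_plus lg ls s)%:P) * ('X - (lambda_minus lg ls s)%:P).
Proof.
have hsum : lambda_plus lg ls s + lambda_minus lg ls s = lg + ls.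
  by rewrite /lambda_plus /lambda_minus; field.
have hprod : lambda_plus lg ls s * lambda_minus lg ls s
    = lg * ls - b * (eps%:C * c).
  (* As a difference of squares, the product involves [s] only through [s ^+ 2], so [hs] removes the
     root and its sign is immaterial. *)
  rewrite /lambda_plus /lambda_minus mulrC -subr_sqr hs.
  by field.
have hchar : char_poly (Mr lg ls b c eps) =
    ('X - (lambda_plus lg ls s)%:P) * ('X - (lambda_minus lg ls s)%:P).
  rewrite char_poly22 !mxE /= -hsum -hprod polyCD polyCM.
  by ring.
(* Eigenvalues are the roots of the characteristic polynomial, now a product of two linear
   factors. *)
split=> // x; rewrite eigenvalue_root_char hchar rootM !root_XsubC.
by split=> [/orP[]/eqP|[]->]; rewrite ?eqxx ?orbT; auto.
Qed.
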